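(* For any positive integers $n \ge k \ge 1$, the balanced chromatic number of the Kneser signed graph $KS(n,k)$ satisfies $$\chi_b(KS(n,k)) = n-k+1.$$
   Context: A signed graph $(G,\sigma)$ is a graph $G$ (loops and parallel edges allowed) with a signature $\sigma: E(G)\to\{-1,+1\}$; an edge $e$ is positive if $\sigma(e)=+1$ and negative if $\sigma(e)=-1$. Switching a vertex $v$ means flipping the signs of all non-loop edges incident with $v$. Two signatures on the same graph are switching equivalent if one is obtained from the other by a sequence of vertex switchings. $(G,\sigma)$ is balanced if it is switching equivalent to the signature that is constantly positive. A set $X\subseteq V(G)$ is balanced if the signed subgraph induced by $X$ is balanced. A balanced $p$-colouring of $(G,\sigma)$ is a map $f:V(G)\to[p]=\{1,\dots,p\}$ such that $f^{-1}(i)$ is a balanced set for each $i\in[p]$; the balanced chromatic number $\chi_b(G,\sigma)$ is the minimum $p$ such that $(G,\sigma)$ has a balanced $p$-colouring. Write $\pm[n]=\{\pm1,\pm2,\dots,\pm n\}$ and $-A=\{-a:a\in A\}$. A signed $k$-subset of $[n]$ is a $k$-element subset $A$ of $\pm[n]$ with $A\cap(-A)=\emptyset$. The Kneser signed graph $KS(n,k)$ has as vertices all signed $k$-subsets of $[n]$; vertices $A,B$ are joined by a positive edge if $A\cap(-B)=\emptyset$, and are joined by a negative edge if $A\cap B=\emptyset$ (so two vertices may be joined by two parallel edges of opposite signs; each vertex carries a positive loop, which is irrelevant to balance). *)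

(* Defs.v *)
From HB Require Import structures.
From mathcomp Require Import all_boot.

Set Implicit Arguments.
Unset Strict Implicit.
Unset Printing Implicit Defensive.

(* Finite graphs with loops and parallel edges; an edge is a loop when its set
   of ends is a singleton. *)
Record mgraph := MGraph {
  vertex : finType;
  edge : finType;
  ends : edge -> {set vertex};
  card_ends : forall e, 0 < #|ends e| <= 2
}.

Definition loop (G : mgraph) (e : edge G) : bool := #|ends e| == 1.

(* The sign +1 is encoded by true and the sign -1 by false. *)
Definition signature (G : mgraph) := {ffun edge G -> bool}.

Record sgraph := SGraph {
  graph_of :> mgraph;
  sign : signature graph_of
}.

Definition switch (G : mgraph) (s : signature G) (v : vertex G) : signature G :=
  [ffun e => if ~~ loop e && (v \in ends e) then ~~ s e else s e].

Definition switching_equivalent (G : mgraph) (s t : signature G) : Prop :=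
  exists vs : seq (vertex G), foldl (@switch G) s vs = t.

Definition balanced (G : sgraph) : Prop :=
  switching_equivalent (sign G) [ffun=> true].

Section Induced.
Variables (G : sgraph) (X : {set vertex G}).

Definition ind_vertex := {x : vertex G | x \in X}.
Definition ind_edge := {e : edge G | ends e \subset X}.
Definition ind_ends (e : ind_edge) : {set ind_vertex} :=
  [set x | val x \in ends (val e)].

Lemma ind_card_ends (e : ind_edge) : 0 < #|ind_ends e| <= 2.
Proof.
suff -> : #|ind_ends e| = #|ends (val e)| by apply: card_ends.
rewrite -(card_imset _ val_inj); apply: eq_card => y.
apply/imsetP/idP => [[x xe ->]|ye]; first by rewrite inE in xe.
have yX : y \in X by apply: (subsetP (valP e)).
by exists (Sub y yX : ind_vertex); rewrite ?inE SubK.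
Qed.

Definition induced : sgraph :=
  @SGraph (MGraph ind_card_ends) [ffun e : ind_edge => sign G (val e)].

End Induced.

Definition balanced_set (G : sgraph) (X : {set vertex G}) : Prop :=
  balanced (induced X).

Definition balanced_colouring (G : sgraph) (p : nat)
    (f : vertex G -> 'I_p) : Prop :=
  forall i : 'I_p, balanced_set [set x | f x == i].

Definition balanced_colourable (G : sgraph) (p : nat) : Prop :=
  exists f : vertex G -> 'I_p, balanced_colouring f.

(* chi_b(G) = p.  This is a relation because a graph with a negative loop has
   no balanced colouring at all, hence no balanced chromatic number. *)
Definition is_balanced_chromatic_number (G : sgraph) (p : nat) : Prop :=
  balanced_colourable G p /\ forall q, balanced_colourable G q -> p <= q.

(* The elements of +-[n]: (i, true) stands for i + 1, (i, false) for -(i + 1). *)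
Definition pm (n : nat) := ('I_n * bool)%type.

Definition opp (n : nat) (a : pm n) : pm n := (a.1, ~~ a.2).

Definition oppset (n : nat) (A : {set pm n}) : {set pm n} :=
  [set opp a | a in A].

Definition signed_subset (n k : nat) :=
  {A : {set pm n} | (#|A| == k) && (A :&: oppset A == set0)}.

Section Kneser.
Variables n k : nat.

Definition ks_adj (s : bool) (A B : signed_subset n k) : bool :=
  if s then val A :&: oppset (val B) == set0 else val A :&: val B == set0.

(* An edge is a sign together with an unordered pair of ends, so that two
   vertices are joined by at most one edge of each sign. *)
Definition ks_edge :=
  {u : bool * {set signed_subset n k} |
    [exists A, exists B, (u.2 == [set A; B]) && ks_adj u.1 A B]}.

Definition ks_ends (e : ks_edge) : {set signed_subset n k} := (val e).2.

Lemma ks_card_ends (e : ks_edge) : 0 < #|ks_ends e| <= 2.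
Proof.
have /existsP[A /existsP[B /andP[/eqP eAB _]]] := valP e.
by rewrite /ks_ends eAB cards2; case: (A != B).
Qed.

Definition KS : sgraph :=
  @SGraph (MGraph ks_card_ends) [ffun e : ks_edge => (val e).1].

End Kneser.

(* Main.v *)
Require Import Defs.
From mathcomp Require Import all_boot.

(** A class of a balanced colouring is a family of signed sets that can be
    resigned so that any two of its members meet (Harary's criterion, see
    [balancedP] and [KS_balanced_setP]).  A balanced p-colouring is thus a map
    to the signed colours +-[p] such that sets of equal colour meet, and a set
    meets the opposite of every set of the opposite colour
    ([KS_colourableP]).

    Upper bound.  Colour a set by its element of least absolute value: sets of
    equal colour share that element, and sets of opposite colours contain
    opposite elements.  A signed k-set has k distinct absolute
    values, so the least of them is at most n - k + 1.

    Lower bound.  Given a signed colouring with p colours, label every nonempty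
    signed set X of fewer than k elements by its size, with a sign that is
    opposite for X and -X, and every larger X by k - 1 + j, where j is the
    largest colour of a k-subset of X or of -X, with the sign of that colour
    (reversed for a k-subset of -X).  The colouring condition says precisely
    that a colour cannot occur in X with both signs.  The labelling is
    therefore antipodal and never takes opposite labels on nested sets
    ([kneser_label_tucker]), and the octahedral Tucker lemma
    ([octahedral_tucker]) gives n <= k - 1 + p.

    The Tucker lemma follows from Ky Fan's parity theorem ([fan_parity]): the
    number of maximal flags of signed sets whose labels, sorted by absolute
    value, have signs +, -, +, ... is odd.  Modulo 2, let P_d be the cochain
    that tests whether d labels alternate beginning with +, and N_d the one for
    beginning with -.  A purely combinatorial fact about words of signs is that
    the coboundary of P_d is P_(d+1) + N_(d+1)
    ([facet_sum_alternating_labels]).  Since the labelling is antipodal, the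
    value of P_(d+1) on the sphere is the value of P_(d+1) + N_(d+1) on a
    hemisphere, hence the value of P_d on the boundary of the hemisphere, which
    is the sphere one dimension lower ([hemisphere_boundary]).  Induction
    ends at the empty flag, where the value is 1.  An alternating flag has n
    labels with distinct absolute values, so at least n absolute values are
    used. *)

Set Implicit Arguments.
Unset Strict Implicit.
Unset Printing Implicit Defensive.

Notation "\xor_ ( i 'in' A ) F" := (\big[addb/false]_(i in A) F)
  (at level 41, F at level 41, i, A at level 50).
Notation "\xor_ ( i <- r ) F" := (\big[addb/false]_(i <- r) F)
  (at level 41, F at level 41, i, r at level 50).

(** * Coboundary of a cochain modulo 2 *)

(** The coboundary of [phi] evaluated at the simplex [t]: the sum of [phi] over
    the words obtained from [t] by deleting one entry. *)
Fixpoint facet_sum (T : Type) (phi : seq T -> bool) (t : seq T) : bool :=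
  if t is x :: t' then phi t' (+) facet_sum (fun u => phi (x :: u)) t'
  else false.

Lemma eq_facet_sum (T : eqType) (phi psi : seq T -> bool) (t : seq T) :
  (forall u, subseq u t -> phi u = psi u) -> facet_sum phi t = facet_sum psi t.
Proof.
elim: t phi psi => //= x t IH phi psi eq_phi.
congr addb; first by apply: eq_phi; apply: subseq_cons.
by apply: IH => u ut; apply: eq_phi; rewrite /= eqxx.
Qed.

Lemma facet_sum_map (T U : Type) (h : T -> U) (phi : seq U -> bool) t :
  facet_sum (fun u => phi (map h u)) t = facet_sum phi (map h t).
Proof. by elim: t phi => //= x t IH phi; rewrite -IH. Qed.

(** For a cochain that ignores the order of the vertices, facets can be indexed
    by vertices instead of positions; this makes the coboundary ignore the order
    as well. *)
Lemma facet_sum_rem (T : eqType) (phi : seq T -> bool) (t : seq T) :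
  (forall u v, perm_eq u v -> phi u = phi v) ->
  facet_sum phi t = \xor_(x <- t) phi (rem x t).
Proof.
elim: t phi => [|x t IH] phi phiP /=; first by rewrite big_nil.
rewrite big_cons /= eqxx IH => [|u v uv]; last by apply: phiP; rewrite perm_cons.
congr addb; apply: eq_big_seq => y yt; apply: phiP.
case: eqP => [->|_]; rewrite ?perm_refl // perm_sym.
by apply: perm_to_rem.
Qed.

Lemma perm_facet_sum (T : eqType) (phi : seq T -> bool) (t u : seq T) :
  (forall u v, perm_eq u v -> phi u = phi v) ->
  perm_eq t u -> facet_sum phi t = facet_sum phi u.
Proof.
move=> phiP tu; rewrite !facet_sum_rem // (perm_big _ tu).
apply: eq_big_seq => x xu; apply: phiP; rewrite -(perm_cons x).
have xt : x \in t by rewrite (perm_mem tu).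
by rewrite -(permPl (perm_to_rem xt)) (permPl tu) perm_to_rem.
Qed.

(** * Alternating labels *)

Fixpoint alternating (b : bool) (s : seq bool) : bool :=
  if s is c :: s' then (c == b) && alternating (~~ b) s' else true.

(** Deleting an end of an alternating word leaves an alternating word, which
    begins with the same sign if the last letter is deleted and with the other
    sign if the first one is.  A word that does not alternate has either no
    alternating facet, or two of the same kind, obtained by deleting one or the
    other of two equal neighbours. *)
Lemma facet_sum_alternating b s :
  facet_sum (alternating b) s = alternating b s (+) alternating (~~ b) s.
Proof.
elim: s b => [|c s IH] b /=; first by [].
have -> : facet_sum (fun u => (c == b) && alternating (~~ b) u) s =
          (c == b) && facet_sum (alternating (~~ b)) s.
  by case: (c == b) => //=; elim: {IH} s => //= d s ->.
by rewrite IH negbK; case: c b => [] []; rewrite /= ?addbF ?addbA ?addbb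
  // addbC addbA addbb.
Qed.

Lemma alternating_negb b s : alternating b (map negb s) = alternating (~~ b) s.
Proof. by elim: s b => //= c s IH b; rewrite IH; case: c b => [] []. Qed.

Definition label := (nat * bool)%type.
Definition opplabel (a : label) : label := (a.1, ~~ a.2).
(** The sign breaks ties between labels of equal absolute value, which makes
    the order antisymmetric, so that sorting depends on the multiset only. *)
Definition code (a : label) : nat := a.1.*2 + a.2.
Definition le_label : rel label := relpre code leq.

Lemma opplabelK : involutive opplabel.
Proof. by case=> j b; rewrite /opplabel /= negbK. Qed.

Lemma code_inj : injective code.
Proof.
move=> [i b] [j c] /= eq_ij.
have := congr1 odd eq_ij; have := congr1 half eq_ij.
rewrite /code /= ![_.*2 + _]addnC !half_bit_double !oddD !odd_double !addbF.
by rewrite !oddb => -> ->.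
Qed.

Lemma le_label_total : total le_label.
Proof. by move=> a b; apply: leq_total. Qed.

Lemma le_label_trans : transitive le_label.
Proof. by move=> a b c; apply: leq_trans. Qed.

Lemma le_label_anti : antisymmetric le_label.
Proof. by move=> a b /anti_leq /code_inj. Qed.

Definition compatible (t : seq label) : Prop :=
  {in t &, forall a b, b != opplabel a}.

Lemma code_lt a b : a.1 < b.1 -> code a < code b.
Proof.
move=> lt_ab; rewrite /code (leq_trans (n := a.1.+1.*2)) ?doubleS.
- by [].
- by case: (a.2); rewrite ?addn0 ?addn1.
by rewrite (leq_trans _ (leq_addr _ _)) // -doubleS leq_double.
Qed.

(** Without opposite pairs of labels the tie-breaking is void, so that the order
    is invariant under changing all the signs. *)
Lemma le_label_compat t : compatible t ->
  {in t &, forall a b, le_label a b = (a.1 < b.1) || (a == b)}.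
Proof.
move=> ct a b at_ bt; have := ct a b at_ bt; rewrite /le_label /=.
case: (ltngtP a.1 b.1) => [ab _|ba _|eq_ab neq_ab] /=.
- by rewrite ltnW ?code_lt.
- rewrite leqNgt code_lt //=; apply/esym/negbTE.
  by apply: contraTneq ba => ->; rewrite ltnn.
suff -> : a = b by rewrite leqnn eqxx.
case: a b eq_ab neq_ab {at_ bt} => [i c] [j d] /= ->.
by rewrite /opplabel xpair_eqE eqxx /=; case: c d => [] [].
Qed.

Definition alternating_labels (b : bool) (t : seq label) : bool :=
  alternating b (map snd (sort le_label t)).

Lemma perm_alternating_labels b t u :
  perm_eq t u -> alternating_labels b t = alternating_labels b u.
Proof.
rewrite /alternating_labels => /(perm_sortP le_label_total le_label_trans le_label_anti).
by move=> ->.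
Qed.

(** Sorting commutes with deletion, so the statement reduces to the words of
    signs. *)
Lemma facet_sum_alternating_labels b t :
  facet_sum (alternating_labels b) t =
  alternating_labels b t (+) alternating_labels (~~ b) t.
Proof.
rewrite (perm_facet_sum (u := sort le_label t)); first last.
- by rewrite perm_sym perm_sort.
- by move=> u v; apply: perm_alternating_labels.
rewrite -facet_sum_alternating -facet_sum_map; apply: eq_facet_sum => u ut.
rewrite /alternating_labels sorted_sort //; first exact: le_label_trans.
apply: (subseq_sorted le_label_trans ut); apply: sort_sorted.
exact: le_label_total.
Qed.

Lemma alternating_labels_opp b t : compatible t ->
  alternating_labels b (map opplabel t) = alternating_labels (~~ b) t.
Proof.
move=> ct; rewrite /alternating_labels -alternating_negb -map_comp.
have -> : sort le_label (map opplabel t) = map opplabel (sort le_label t).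
  apply: (homo_sort_map_in (P := mem t)) => //.
  - by move=> a c _ _ /le_label_anti /(can_inj opplabelK).
  - by move=> a c d _ _ _; apply: le_label_trans.
  - by move=> a c _ _; apply: le_label_total.
  - move=> a c at_ ct_; rewrite (le_label_compat ct) // => /orP[lt_ac|/eqP->].
      by rewrite /le_label /= ltnW ?code_lt.
    exact: leqnn.
by rewrite -map_comp.
Qed.

(** Sorted neighbours have different signs; as they are not opposite, their
    absolute values differ, so that the absolute values increase strictly. *)
Lemma alternating_labels_size b t m : compatible t -> alternating_labels b t ->
  {in t, forall a, a.1 < m} -> size t <= m.
Proof.
move=> ct; rewrite /alternating_labels => alt_t lt_m.
rewrite -(size_sort le_label) -(size_map fst) -(size_iota 0 m).
have st : {subset sort le_label t <= t} by move=> a; rewrite mem_sort.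
apply: uniq_leq_size; last first.
  by move=> _ /mapP[a /st /lt_m am ->]; rewrite mem_iota.
apply: (sorted_uniq ltn_trans ltnn).
have := sort_sorted le_label_total t.
elim: (sort le_label t) b alt_t st => // a s IH b /= /andP[/eqP ab alt_s] st le_s.
case: s IH alt_s st le_s => //= c s IH /andP[/eqP cb alt_s] st /andP[le_ac le_s].
apply/andP; split; last first.
  apply: (IH (~~ b)) => //=; first by rewrite cb eqxx.
  by move=> d ds; apply: st; rewrite in_cons ds orbT.
move: le_ac; rewrite (le_label_compat ct) ?st ?inE ?eqxx ?orbT //.
by case/orP => // /eqP eq_ac; move: cb; rewrite -eq_ac ab; case: (b).
Qed.

(** * Maximal flags below a set *)

(** The value of [phi] on the barycentric subdivision of the simplex [S] with
    [m] vertices: the sum of [phi] over the flags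
    [S; S minus a vertex; ...; a single vertex]. *)
Fixpoint flag_sum (T : finType) (m : nat) (phi : seq {set T} -> bool)
    (S : {set T}) : bool :=
  if m is m'.+1 then
    \xor_(a in S) flag_sum m' (fun t => phi (S :: t)) (S :\ a)
  else phi [::].

Definition chain_below (T : finType) (S : {set T}) (t : seq {set T}) : Prop :=
  pairwise (fun X Y : {set T} => Y \subset X) t /\
  {in t, forall X, X != set0 /\ X \subset S}.

Lemma eq_flag_sum (T : finType) m (phi psi : seq {set T} -> bool) (S : {set T}) :
  #|S| = m ->
  (forall t, size t = m -> chain_below S t -> phi t = psi t) ->
  flag_sum m phi S = flag_sum m psi S.
Proof.
elim: m phi psi S => [|m IH] phi psi S /= cardS eq_phi.
  by apply: eq_phi => //; split.
apply: eq_bigr => a aS; apply: IH => [|t size_t [t_chain t_below]].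
  by move: cardS; rewrite (cardsD1 a) aS => -[].
apply: eq_phi; rewrite /= ?size_t //; split.
  rewrite /= t_chain andbT; apply/allP => X /t_below[_ XS].
  exact: subset_trans XS (subD1set _ _).
move=> X; rewrite inE => /predU1P[->|/t_below[X0 XS]].
  by split=> //; apply/set0Pn; exists a.
by split=> //; apply: subset_trans XS (subD1set _ _).
Qed.

Lemma flag_sum_add (T : finType) m (phi psi : seq {set T} -> bool) (S : {set T}) :
  flag_sum m (fun t => phi t (+) psi t) S =
  flag_sum m phi S (+) flag_sum m psi S.
Proof.
elim: m phi psi S => //= m IH phi psi S; rewrite -big_split /=.
by apply: eq_bigr => a _; rewrite IH.
Qed.

Lemma flag_sum0 (T : finType) m (S : {set T}) :
  flag_sum m (fun _ => false) S = false.
Proof. by elim: m S => //= m IH S; rewrite big1. Qed.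

Lemma imset_setD1 (T U : finType) (h : T -> U) (S : {set T}) a :
  injective h -> h @: S :\ h a = h @: (S :\ a).
Proof.
move=> h_inj; apply/setP => y; rewrite in_setD1.
apply/andP/imsetP => [[ya /imsetP[x xS eq_y]]|[x]].
  exists x => //; rewrite in_setD1 xS andbT.
  by apply: contraNneq ya => <-; rewrite eq_y.
rewrite in_setD1 => /andP[xa xS] ->.
by rewrite (inj_eq h_inj) xa imset_f.
Qed.

Lemma flag_sum_imset (T : finType) (h : T -> T) m phi (S : {set T}) :
  injective h ->
  flag_sum m phi (h @: S) =
  flag_sum m (fun t => phi (map (fun X : {set T} => h @: X) t)) S.
Proof.
move=> h_inj; elim: m phi S => //= m IH phi S.
rewrite big_imset /=; last by move=> a b _ _; apply: h_inj.
by apply: eq_bigr => a aS; rewrite imset_setD1 ?IH.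
Qed.

(** Two elements can be removed in either order, so the terms cancel in
    pairs. *)
Lemma xor_remove_two (T : finType) (g : {set T} -> bool) (S : {set T}) :
  \xor_(a in S) \xor_(b in S :\ a) g (S :\ a :\ b) = false.
Proof.
pose lt (a b : T) := enum_rank a < enum_rank b.
pose h a b := lt a b && g (S :\ a :\ b).
transitivity (\xor_(a in S) \xor_(b in S) (h a b (+) h b a)).
  apply: eq_bigr => a aS; rewrite big_mkcond [RHS]big_mkcond.
  apply: eq_bigr => b _; rewrite in_setD1 /h [S :\ b :\ a]setDDl.
  rewrite setUC -setDDl /lt.
  case: (b \in S); rewrite ?andbF // andbT -(inj_eq enum_rank_inj).
  by rewrite -val_eqE; case: ltngtP => //=; rewrite addbF.
under eq_bigr do rewrite big_split /=.
by rewrite big_split /= [X in _ (+) X]exchange_big /= addbb.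
Qed.

(** Boundary of the barycentric subdivision of a simplex: deleting any member
    but the top [S] of a flag leaves a gap that can be filled in two ways, so
    only the subdivisions of the facets of [S] remain. *)
Lemma flag_sum_facet (T : finType) m phi (S : {set T}) :
  flag_sum m.+1 (facet_sum phi) S = \xor_(a in S) flag_sum m phi (S :\ a).
Proof.
elim: m phi S => [|m IH] phi S.
  by apply: eq_bigr => a _ /=; rewrite addbF.
transitivity (\xor_(a in S) (flag_sum m.+1 phi (S :\ a) (+)
   flag_sum m.+1 (facet_sum (fun u => phi (S :: u))) (S :\ a))).
  by apply: eq_bigr => a _; rewrite -flag_sum_add.
rewrite big_split -[RHS]addbF; congr addb.
by under eq_bigr do rewrite IH; apply: xor_remove_two.
Qed.

(** * The boundary of the cross-polytope *)

(** Sum over the facets of the cross-polytope with axes [l], one for each choice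
    of a sign on every axis. *)
Fixpoint sphere_sum n (l : seq 'I_n) (g : {set pm n} -> bool) : bool :=
  if l is i :: l' then
    sphere_sum l' (fun S => g ((i, true) |: S)) (+)
    sphere_sum l' (fun S => g ((i, false) |: S))
  else g set0.

Lemma oppK n : involutive (@opp n).
Proof. by case=> i b; rewrite /opp /= negbK. Qed.

Lemma oppsetK n : involutive (@oppset n).
Proof.
move=> S; rewrite /oppset -imset_comp -[RHS]imset_id.
by apply: eq_imset => a /=; rewrite oppK.
Qed.

Lemma mem_oppset n (S : {set pm n}) a : (a \in oppset S) = (opp a \in S).
Proof. by rewrite -{1}[a]oppK mem_imset //; apply: (can_inj (@oppK n)). Qed.

Lemma oppsetU1 n (a : pm n) S : oppset (a |: S) = opp a |: oppset S.
Proof. by rewrite /oppset imsetU1. Qed.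

(** The facets of the cross-polytope with axes [l], described intrinsically. *)
Definition orthant n (l : seq 'I_n) (S : {set pm n}) : Prop :=
  [/\ #|S| = size l, S :&: oppset S = set0 & {in S, forall a, a.1 \in l}].

Lemma orthant_notin n (i : 'I_n) l S b : i \notin l -> orthant l S -> (i, b) \notin S.
Proof. by move=> il [_ _ Sl]; apply: contra il => /Sl. Qed.

Lemma orthantU1 n (i : 'I_n) l S b :
  i \notin l -> orthant l S -> orthant (i :: l) ((i, b) |: S).
Proof.
move=> il oS; have [cardS SS Sl] := oS; split.
- by rewrite cardsU1 (orthant_notin _ il oS) cardS.
- apply/setP => -[j c]; rewrite oppsetU1 !inE mem_oppset /opp /=.
  move/setP/(_ (j, c)): SS; rewrite !inE mem_oppset /opp /=.
  rewrite !xpair_eqE; case: (eqVneq j i) => [->|_] //= _.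
  rewrite !(negbTE (orthant_notin _ il oS)) !orbF.
  by case: b c => [] [].
- by move=> a; rewrite !inE => /predU1P[->|/Sl ->]; rewrite ?eqxx ?orbT.
Qed.

Lemma eq_sphere_sum n (l : seq 'I_n) g h : uniq l ->
  (forall S, orthant l S -> g S = h S) -> sphere_sum l g = sphere_sum l h.
Proof.
elim: l g h => [|i l IH] g h /=.
  move=> _; apply; split; rewrite ?cards0 ?set0I //.
  by move=> a; rewrite inE.
case/andP=> il ul eq_g; congr addb; apply: IH => // S oS; apply: eq_g;
  exact: orthantU1.
Qed.

Lemma sphere_sum_add n (l : seq 'I_n) g h :
  sphere_sum l (fun S => g S (+) h S) = sphere_sum l g (+) sphere_sum l h.
Proof. by elim: l g h => //= i l IH g h; rewrite !IH addbACA. Qed.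

Lemma sphere_sum_opp n (l : seq 'I_n) g : uniq l ->
  sphere_sum l (fun S => g (oppset S)) = sphere_sum l g.
Proof.
elim: l g => [|i l IH] g /=; first by rewrite /oppset imset0.
case/andP=> il ul; rewrite addbC -!(IH (fun S => g (_ |: S))) //.
by congr addb; apply: eq_sphere_sum => // S _; rewrite oppsetU1.
Qed.

(** The sphere is the union of a hemisphere and its antipode. *)
Lemma sphere_sum_hemisphere n i (l : seq 'I_n) g : uniq l ->
  sphere_sum (i :: l) g =
  sphere_sum l (fun S => g ((i, true) |: S) (+) g (oppset ((i, true) |: S))).
Proof.
move=> ul /=; rewrite sphere_sum_add; congr addb.
rewrite -(sphere_sum_opp (fun S => g (_ |: S))) //.
by apply: eq_sphere_sum => // S _; rewrite oppsetU1.
Qed.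

Lemma ridge_sumU1 n i (l : seq 'I_n) b S g : i \notin l -> orthant l S ->
  \xor_(a in (i, b) |: S) g (((i, b) |: S) :\ a) =
  g S (+) \xor_(a in S) g ((i, b) |: (S :\ a)).
Proof.
move=> il oS; have iS := orthant_notin b il oS.
rewrite big_setU1 //= setU1K //; congr addb; apply: eq_bigr => a aS.
rewrite setDUl; congr (g (_ :|: _)).
apply/setDidPl; rewrite disjoints1 inE.
by apply: contraNneq iS => ->.
Qed.

(** The cross-polytope boundary is a cycle mod 2: each of its ridges lies in
    exactly two orthants, which differ in the sign of one coordinate. *)
Lemma sphere_sum_ridges n (l : seq 'I_n) g : uniq l ->
  sphere_sum l (fun S => \xor_(a in S) g (S :\ a)) = false.
Proof.
elim: l g => [|i l IH] g /=; first by rewrite big_set0.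
case/andP=> il ul.
have split_top b : sphere_sum l
    (fun S => \xor_(a in (i, b) |: S) g (((i, b) |: S) :\ a)) =
    sphere_sum l g.
  transitivity (sphere_sum l (fun S => g S (+)
      \xor_(a in S) g ((i, b) |: (S :\ a)))).
    by apply: eq_sphere_sum => // S oS; apply: ridge_sumU1 oS.
  by rewrite sphere_sum_add (IH (fun S => g ((i, b) |: S))) ?addbF.
by rewrite !split_top addbb.
Qed.

(** The boundary of the hemisphere where coordinate [i] is positive is the
    equator, that is, the sphere on the remaining coordinates. *)
Lemma hemisphere_boundary n i (l : seq 'I_n) g : i \notin l -> uniq l ->
  sphere_sum l (fun S => \xor_(a in (i, true) |: S) g (((i, true) |: S) :\ a)) =
  sphere_sum l g.
Proof.
move=> il ul.
transitivity (sphere_sum l (fun S => g S (+)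
    \xor_(a in S) g ((i, true) |: (S :\ a)))).
  by apply: eq_sphere_sum => // S oS; apply: ridge_sumU1 oS.
by rewrite sphere_sum_add (sphere_sum_ridges (fun S => g ((i, true) |: S))) ?addbF.
Qed.

(** * Fan's parity theorem and the octahedral Tucker lemma *)

Definition tucker_labelling n (lam : {set pm n} -> label) : Prop :=
  (forall X : {set pm n}, X != set0 -> X :&: oppset X = set0 ->
     lam (oppset X) = opplabel (lam X)) /\
  (forall X Y : {set pm n}, X != set0 -> X \subset Y -> Y :&: oppset Y = set0 ->
     lam Y != opplabel (lam X)).

Lemma signedS n (X Y : {set pm n}) :
  X \subset Y -> Y :&: oppset Y = set0 -> X :&: oppset X = set0.
Proof.
move=> XY YY; apply/eqP; rewrite -subset0 -YY.
by apply: setISS => //; apply: imsetS.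
Qed.

Lemma chain_compatible n lam (S : {set pm n}) t : tucker_labelling lam ->
  S :&: oppset S = set0 -> chain_below S t -> compatible (map lam t).
Proof.
case=> _ lamP SS [t_chain t_below] _ _ /mapP[X Xt ->] /mapP[Y Yt ->].
have [X0 XS] := t_below X Xt; have [Y0 YS] := t_below Y Yt.
have : (X \subset Y) || (Y \subset X).
  elim: t t_chain Xt Yt {t_below} => //= Z t IH /andP[/allP Zt t_chain].
  rewrite !inE => /predU1P[->|Xt] /predU1P[->|Yt].
  - by rewrite subxx.
  - by rewrite Zt ?orbT.
  - by rewrite Zt.
  exact: IH.
case/orP=> [XY|YX]; first by apply: lamP => //; apply: signedS SS.
have := lamP _ _ Y0 YX (signedS XS SS).
by apply: contraNneq => ->; rewrite opplabelK.
Qed.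

(** Fan's theorem, for the restriction of the labelling to the axes in [l].  The
    induction adds one axis: antipodality folds the sphere onto a hemisphere and
    turns the cochain into a coboundary, which is then evaluated on the
    equator. *)
Lemma fan_parity n (lam : {set pm n} -> label) (l : seq 'I_n) :
  tucker_labelling lam -> uniq l ->
  sphere_sum l (flag_sum (size l) (fun t => alternating_labels true (map lam t))).
Proof.
move=> lamT; pose p b (t : seq {set pm n}) := alternating_labels b (map lam t).
rewrite -[X in flag_sum _ X]/(p true).
elim: l => [|i l IH] // /andP[il ul].
rewrite sphere_sum_hemisphere //; apply: etrans (IH ul).
rewrite -[RHS](hemisphere_boundary _ il) //; apply: eq_sphere_sum => // S oS.
have oT := orthantU1 true il oS; have [cardT TT _] := oT.
rewrite -flag_sum_facet flag_sum_imset; last exact: can_inj (@oppK n).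
rewrite -flag_sum_add; apply: eq_flag_sum => // t _ t_chain.
rewrite facet_sum_map facet_sum_alternating_labels; congr addb.
have ct := chain_compatible lamT TT t_chain.
rewrite -(alternating_labels_opp true) // /p -!map_comp; congr alternating_labels.
apply/eq_in_map => X Xt /=; apply: (proj1 lamT).
  by case: (proj2 t_chain X Xt).
by apply: signedS TT; case: (proj2 t_chain X Xt).
Qed.

(** An odd number of alternating flags means that there is one, and its [n]
    labels have distinct absolute values. *)
Lemma octahedral_tucker n m (lam : {set pm n} -> label) :
  tucker_labelling lam ->
  (forall X : {set pm n}, X != set0 -> X :&: oppset X = set0 -> (lam X).1 < m) ->
  n <= m.
Proof.
move=> lamT lam_m; rewrite leqNgt; apply/negP => lt_mn.
have := fan_parity lamT (enum_uniq 'I_n); rewrite size_enum_ord.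
set phi := (fun t => _).
have -> : sphere_sum (enum 'I_n) (flag_sum n phi) =
          sphere_sum (enum 'I_n) (fun _ => false).
  apply: eq_sphere_sum => [|S [cardS SS _]]; first exact: enum_uniq.
  rewrite size_enum_ord in cardS.
  rewrite -[RHS](flag_sum0 n S); apply: eq_flag_sum => // t size_t t_chain.
  apply/negP => alt_t.
  suff : n <= m by rewrite leqNgt lt_mn.
  rewrite -size_t -(size_map lam).
  apply: alternating_labels_size (chain_compatible lamT SS t_chain) alt_t _.
  move=> _ /mapP[X Xt ->]; have [X0 XS] := proj2 t_chain X Xt.
  by apply: lam_m => //; apply: signedS SS.
by elim: (enum _) => //= i l; case: sphere_sum.
Qed.

(** * Balance of signed graphs *)

Lemma foldl_switchE (G : mgraph) (s : signature G) vs e :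
  foldl (@switch G) s vs e =
  s e (+) (~~ loop e && \xor_(v <- vs) (v \in ends e)).
Proof.
elim: vs s => [|v vs IH] s /=; first by rewrite big_nil andbF addbF.
rewrite IH big_cons ffunE.
by case: (loop e); case: (v \in ends e); rewrite //= addNb addbN.
Qed.

(** The parity of the number of times that a vertex is switched. *)
Definition potential (V : finType) (vs : seq V) (v : V) : bool :=
  \xor_(w <- vs) (w == v).

Lemma foldl_switch_ends (G : mgraph) (s : signature G) vs e u v :
  ends e = [set u; v] ->
  foldl (@switch G) s vs e = s e (+) (potential vs u (+) potential vs v).
Proof.
move=> e_uv; rewrite foldl_switchE /loop e_uv cards2; congr addb.
case: (eqVneq u v) => [->|uv] /=; first by rewrite addbb.
rewrite -big_split; apply: eq_bigr => w _; rewrite !inE /=.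
by case: (eqVneq w u) => [->|] //=; rewrite (negbTE uv).
Qed.

Lemma potential_enum (V : finType) (A : {set V}) v :
  potential (enum A) v = (v \in A).
Proof.
rewrite /potential -mem_enum; have := enum_uniq A.
elim: (enum A) => [|w s IH] /=; first by rewrite big_nil.
case/andP=> ws us; rewrite big_cons inE IH // eq_sym.
by case: eqP => //= ->; rewrite (negbTE ws).
Qed.

Lemma endsP (G : mgraph) (e : edge G) : exists u v, ends e = [set u; v].
Proof.
have /andP[gt0] := card_ends e; rewrite leq_eqVlt => /orP[/cards2P[u [v [_ ->]]]|le1].
  by exists u, v.
have /cards1P[u ->] : #|ends e| == 1 by rewrite eqn_leq gt0 andbT.
by exists u, u; rewrite setUid.
Qed.

(** Harary's criterion: switching changes the sign of an edge by the sum of the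
    potentials of its ends, which is 0 for a loop, as it should be. *)
Lemma balancedP (G : sgraph) : balanced G <->
  exists t : vertex G -> bool,
    forall e u v, ends e = [set u; v] -> sign G e = (t u == t v).
Proof.
split=> [[vs bal]|[t tP]].
  exists (potential vs) => e u v e_uv.
  have := congr1 (fun s : signature G => s e) bal.
  rewrite (foldl_switch_ends _ _ e_uv) ffunE.
  by case: (sign G e); case: (potential vs u); case: (potential vs v).
exists (enum [set v | t v]); apply/ffunP => e; rewrite ffunE.
have [u [v e_uv]] := endsP e.
rewrite (foldl_switch_ends _ _ e_uv) !potential_enum !inE (tP _ _ _ e_uv).
by case: (t u); case: (t v).
Qed.

Lemma balanced_setP (G : sgraph) (X : {set vertex G}) : balanced_set X <->
  exists t : vertex G -> bool, forall e u v, u \in X -> v \in X ->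
    ends e = [set u; v] -> sign G e = (t u == t v).
Proof.
split=> [/balancedP[t tP]|[t tP]]; last apply/balancedP.
  (* The value outside X is arbitrary. *)
  exists (fun u => if insub u is Some u' then t u' else true) => e u v uX vX e_uv.
  have eX : ends e \subset X by rewrite e_uv subUset !sub1set uX.
  have := tP (Sub e eX) (Sub u uX) (Sub v vX); rewrite /= ffunE SubK !insubT => -> //.
  by apply/setP => w; rewrite !inE SubK e_uv !inE.
exists (t \o val) => e u v /setP e_uv; rewrite ffunE.
apply: tP; try exact: valP.
apply/setP => w; case: (boolP (w \in X)) => wX.
  by have := e_uv (Sub w wX); rewrite !inE -!val_eqE SubK.
have /negbTE -> : w \notin ends (val e) by apply: contra wX; apply/subsetP/(valP e).
by rewrite !inE; apply/esym/negbTE; apply: contra wX => /orP[]/eqP->; apply: valP.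
Qed.

Lemma eq_on_set2 (T : finType) (C : eqType) (t : T -> C) (u v a b : T) :
  [set u; v] = [set a; b] -> (t u == t v) = (t a == t b).
Proof.
move/setP=> E; move: (E u) (E v) (E a) (E b); rewrite !inE !eqxx ?orbT /=.
move=> /esym/orP[]/eqP-> /esym/orP[]/eqP->; rewrite ?orbb //.
- by move=> _ /eqP->.
- by move=> /eqP->.
Qed.

(** * Colourings of the Kneser signed graph *)

(** Harary's criterion forbids a negative edge between sets of equal potential
    and a positive one between sets of different potentials. *)
Lemma KS_balanced_setP n k (X : {set vertex (KS n k)}) :
  balanced_set X <->
  exists t : signed_subset n k -> bool, forall A B : signed_subset n k,
    A \in X -> B \in X ->
    if t A == t B then val A :&: val B != set0
    else val A :&: oppset (val B) != set0.
Proof.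
split=> [/balanced_setP[t tP]|[t tP]]; last apply/balanced_setP; exists t.
  move=> A B AX BX.
  have edgeP b : ks_adj b A B -> b = (t A == t B).
    move=> adj.
    have eP : [exists A', exists B', ([set A; B] == [set A'; B']) && ks_adj b A' B'].
      by apply/existsP; exists A; apply/existsP; exists B; rewrite eqxx.
    have := tP (Sub (b, [set A; B]) eP : ks_edge n k) A B AX BX.
    rewrite /= ffunE SubK; apply.
    by rewrite /ks_ends SubK.
  case tAB: (t A == t B); apply/negP => adj.
    by have := edgeP false adj; rewrite tAB.
  by have := edgeP true adj; rewrite tAB.
move=> e u v uX vX e_uv; rewrite ffunE.
have /existsP[A /existsP[B /andP[/eqP eAB adj]]] := valP e.
have eE : [set u; v] = [set A; B] by rewrite -eAB -e_uv.
have [AX BX] : A \in X /\ B \in X.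
  have sX : [set A; B] \subset X by rewrite -eE subUset !sub1set uX.
  by split; apply: (subsetP sX); rewrite !inE eqxx ?orbT.
rewrite (eq_on_set2 t eE).
have := tP A B AX BX; move: adj; rewrite /ks_adj.
by case: (val e).1; case: (t A == t B) => // ->.
Qed.

(** A colour class together with the sign function that balances it: the two
    signs of a colour become two colour classes, in each of which any two sets
    meet, and any set of one meets the opposite of any set of the other. *)
Definition signed_colouring n k p (c : signed_subset n k -> pm p) : Prop :=
  forall A B : signed_subset n k,
    (c A = c B -> val A :&: val B != set0) /\
    (c A = opp (c B) -> val A :&: oppset (val B) != set0).

Lemma KS_colourableP n k p : balanced_colourable (KS n k) p <->
  exists c : signed_subset n k -> pm p, signed_colouring c.
Proof.
split=> [[f fP]|[c cP]].
  have /fin_all_exists[t tP] i : exists t : signed_subset n k -> bool,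
      forall A B : signed_subset n k, f A = i -> f B = i ->
      if t A == t B then val A :&: val B != set0
      else val A :&: oppset (val B) != set0.
    have /KS_balanced_setP[t tP] := fP i.
    by exists t => A B fA fB; apply: tP; rewrite inE ?fA ?fB.
  exists (fun A => (f A, t (f A) A)) => A B; split=> -[fAB tAB].
    by have := tP _ A B fAB erefl; rewrite -{1}fAB tAB eqxx.
  by have := tP _ A B fAB erefl; rewrite -{1}fAB tAB; case: (t _ B).
exists (fun A => (c A).1) => i; apply/KS_balanced_setP.
exists (fun A => (c A).2) => A B; rewrite !inE => /eqP cA /eqP cB.
have [eqP1 neqP] := cP A B; move: cA cB eqP1 neqP.
case: (c A) (c B) => [a x] [b y] /= -> ->; rewrite /opp /=.
case: (x =P y) => [xy|xy] eqP1 neqP1; first by apply: eqP1; rewrite xy.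
by apply: neqP1; congr pair; case: x y xy {eqP1} => [] [].
Qed.

(** Each set is coloured by its element of least absolute value. *)
Lemma KS_colourable n k : 1 <= k -> k <= n ->
  balanced_colourable (KS n k) (n - k + 1).
Proof.
move=> k_gt0 kn; apply/KS_colourableP.
have A_least (A : signed_subset n k) :
    exists2 a : pm n, a \in val A & {in val A, forall b : pm n, a.1 <= b.1}.
  have /set0Pn[a0 a0A] : val A != set0.
    by have /andP[/eqP cardA _] := valP A; rewrite -card_gt0 cardA.
  by case: (arg_minnP (fun a : pm n => a.1 : nat) a0A) => a aA a_min; exists a.
have least_lt (A : signed_subset n k) (a : pm n) :
    {in val A, forall b : pm n, a.1 <= b.1} -> a.1 < n - k + 1.
  move=> a_min; have /andP[/eqP cardA /eqP signedA] := valP A.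
  have fst_inj : {in val A &, injective (fst : pm n -> 'I_n)}.
    move=> [i b] [j c] bA cA /= ij; rewrite -{j}ij in cA *.
    move/setP/(_ (i, b)): signedA; rewrite !inE mem_oppset bA /opp /=.
    by case: b c bA cA => [] [] // _ ->.
  have : k <= n - a.1.
    rewrite -cardA cardE -(size_map (fun b : pm n => b.1 : nat)) -(size_iota a.1 (n - a.1)).
    apply: uniq_leq_size => [|_ /mapP[b bA ->]].
      rewrite map_inj_in_uniq ?enum_uniq // => b c.
      by rewrite !mem_enum => bA cA /val_inj; apply: fst_inj.
    rewrite mem_enum in bA.
    by rewrite mem_iota (subnKC (ltnW (ltn_ord a.1))) ltn_ord a_min.
  by rewrite addn1 ltnS leq_subRL ?(ltnW (ltn_ord _)) // leq_subRL // addnC.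
have /fin_all_exists[c cP] (A : signed_subset n k) : exists c : pm (n - k + 1),
    exists a : pm n, [/\ a \in val A, c.1 = a.1 :> nat & c.2 = a.2].
  have [a aA a_min] := A_least A.
  by exists (Ordinal (least_lt A a a_min), a.2), a.
exists c => A B; have [a [aA cA1 cA2]] := cP A; have [b [bB cB1 cB2]] := cP B.
split=> eq_c; apply/set0Pn; exists a; rewrite inE aA ?mem_oppset.
  suff -> : a = b by [].
  apply/eqP; rewrite -pair_eqE /pair_eq -val_eqE /= -cA1 -cA2 eq_c cB1 cB2.
  by rewrite !eqxx.
suff -> : opp a = b by [].
apply/eqP; rewrite -pair_eqE /pair_eq -val_eqE /= -cA1 -cA2 eq_c /= cB1 cB2.
by rewrite negbK !eqxx.
Qed.

(** * The labelling defined by a colouring *)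

(** A colouring need not be antipodal, so the subsets of the opposite of [X] are
    included, with the opposite colour, to make the set of colours antipodal. *)
Definition colours n k p (c : signed_subset n k -> pm p)
    (X : {set pm n}) : {set pm p} :=
  [set c A | A : signed_subset n k & val A \subset X] :|:
  [set opp (c A) | A : signed_subset n k & val A \subset oppset X].

Lemma colours_opp n k p (c : signed_subset n k -> pm p) X :
  colours c (oppset X) = oppset (colours c X).
Proof.
rewrite /colours oppsetK setUC [RHS]imsetU -!imset_comp.
by congr (_ :|: _); apply: eq_imset => A /=; rewrite oppK.
Qed.

Lemma coloursS n k p (c : signed_subset n k -> pm p) (X Y : {set pm n}) :
  X \subset Y -> colours c X \subset colours c Y.
Proof.
move=> XY; apply: setUSS; apply: imsetS; apply/subsetP => A; rewrite !inE => AX.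
  exact: subset_trans XY.
by apply: subset_trans AX _; apply: imsetS.
Qed.

(** If both signs of a colour occurred, the colouring condition would provide a
    common element of [X] and its opposite. *)
Lemma colours_signed n k p (c : signed_subset n k -> pm p)
    (X : {set pm n}) a : signed_colouring c -> X :&: oppset X = set0 ->
  a \in colours c X -> opp a \notin colours c X.
Proof.
move=> cP XX aX; apply/negP => naX.
have XX' : oppset X :&: oppset (oppset X) = set0 by rewrite oppsetK setIC.
have meet (U V W : {set pm n}) : V :&: W = set0 -> U != set0 -> U \subset V :&: W -> False.
  by move=> -> U0; rewrite subset0 (negbTE U0).
case/setUP: aX naX => /imsetP[A]; rewrite inE => AX -> /setUP[] /imsetP[B]; rewrite inE => BX.
- move/esym => cBA; have /meet := proj2 (cP B A) cBA; apply; first exact: XX.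
  by apply: setISS => //; apply: imsetS.
- move/(can_inj (@oppK p)) => cAB; have /meet := proj1 (cP A B) cAB; apply; first exact: XX.
  exact: setISS.
- rewrite oppK => cAB; have /meet := proj1 (cP A B) cAB; apply; first exact: XX'.
  by rewrite oppsetK; apply: setISS.
- rewrite oppK => cAB; have /meet := proj2 (cP A B) cAB; apply; first exact: XX'.
  by apply: setISS => //; apply: imsetS.
Qed.

(** The default value is never reached on sets of at least [k] elements. *)
Definition top_colour n k p (c : signed_subset n k -> pm p)
    (X : {set pm n}) : label :=
  if [pick a in colours c X | [forall b in colours c X, b.1 <= a.1]] is Some a
  then (a.1 : nat, a.2) else (0, true).

Lemma top_colourP n k p (c : signed_subset n k -> pm p)
    (X : {set pm n}) : k <= #|X| -> X :&: oppset X = set0 ->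
  exists a : pm p, [/\ top_colour c X = (a.1 : nat, a.2), a \in colours c X &
    {in colours c X, forall b : pm p, b.1 <= a.1}].
Proof.
move=> kX XX; rewrite /top_colour; case: pickP => [a /andP[aX /forall_inP a_max]|no_max].
  by exists a.
have /card_geqP[s [us /eqP size_s sX]] := kX.
have cardA : #|[set x in s]| = k by rewrite cardsE (card_uniqP us) (eqP size_s).
have AX : [set x in s] \subset X by apply/subsetP => x; rewrite inE => /sX.
have A_vertex : (#|[set x in s]| == k) && ([set x in s] :&: oppset [set x in s] == set0).
  by rewrite cardA eqxx (signedS AX XX) eqxx.
have cA : c (Sub [set x in s] A_vertex) \in colours c X.
  by rewrite inE imset_f // inE SubK.
case: (arg_maxnP (fun a : pm p => a.1 : nat) cA) => a aX a_max.
by have := no_max a; rewrite /= [a \in _]aX => /forall_inP[].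
Qed.

Lemma top_colour_eq n k p (c : signed_subset n k -> pm p)
    (X : {set pm n}) (a : pm p) :
  signed_colouring c -> k <= #|X| -> X :&: oppset X = set0 ->
  a \in colours c X -> {in colours c X, forall b : pm p, b.1 <= a.1} ->
  top_colour c X = (a.1 : nat, a.2).
Proof.
move=> cP kX XX aX a_max; have [b [-> bX b_max]] := top_colourP c kX XX.
have ab : a.1 = b.1 by apply/val_inj/anti_leq; rewrite a_max ?b_max.
rewrite -ab; congr pair; apply: contraTeq bX => ba.
have -> : b = opp a by case: a b ab ba {aX a_max b_max} => [i x] [j y] /= <-; case: x y => [] [].
exact: colours_signed cP XX aX.
Qed.

(** Absolute values are counted from 0.  Comparing ranks is a way to choose one
    of [X] and its opposite; any antipodal choice of sign would do. *)
Definition kneser_label n k p (c : signed_subset n k -> pm p)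
    (X : {set pm n}) : label :=
  if #|X| < k then (#|X|.-1, enum_rank X < enum_rank (oppset X))
  else (k.-1 + (top_colour c X).1, (top_colour c X).2).

Lemma card_oppset n (X : {set pm n}) : #|oppset X| = #|X|.
Proof. by rewrite card_imset //; apply: (can_inj (@oppK n)). Qed.

(** Nested sets with labels of equal absolute value are either both small, hence
    of the same size and equal, or both large; then the colours of the smaller
    one are colours of the larger one, which excludes opposite signs. *)
Lemma kneser_label_tucker n k p (c : signed_subset n k -> pm p) :
  signed_colouring c -> tucker_labelling (kneser_label c).
Proof.
move=> cP; split=> [X X0 XX|X Y X0 XY YY]; rewrite /kneser_label.
  rewrite card_oppset; case: ltnP => [_|kX].
    rewrite oppsetK /opplabel /=; congr pair.
    rewrite -leqNgt [RHS]leq_eqVlt; case: eqP => //= /val_inj/enum_rank_inj X_eq.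
    by move: X0; rewrite -[X]setIid -{2}X_eq XX eqxx.
  have [a [aE aX a_max]] := top_colourP c kX XX; rewrite aE.
  rewrite (@top_colour_eq _ _ _ _ _ (opp a)) ?card_oppset //.
  - by rewrite oppsetK setIC.
  - by rewrite colours_opp mem_oppset oppK.
  - by move=> b; rewrite colours_opp mem_oppset => /a_max.
have XX := signedS XY YY.
have [Yk|kY] := ltnP #|Y| k.
  rewrite (leq_ltn_trans (subset_leq_card XY) Yk).
  rewrite /opplabel xpair_eqE /=; apply/negP => /andP[/eqP card_eq].
  suff -> : X = Y by case: (_ < _).
  have Y0 : Y != set0 by apply: contraNneq X0 => Y0; rewrite -subset0 -Y0.
  move: X0 Y0; rewrite -!card_gt0 => cX cY.
  by apply/eqP; rewrite eqEcard XY -(prednK cY) card_eq (prednK cX) leqnn.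
have [Xk|kX] := ltnP #|X| k.
  rewrite /opplabel xpair_eqE /= negb_and neq_ltn; apply/orP; left.
  apply/orP; right; apply: leq_trans (leq_addr _ _).
  by rewrite -ltnS !prednK ?card_gt0 // (leq_ltn_trans _ Xk).
have [a [-> aX _]] := top_colourP c kX XX; have [b [-> bY _]] := top_colourP c kY YY.
rewrite /opplabel xpair_eqE /= eqn_add2l; apply/negP => /andP[/eqP/val_inj ba /eqP b2].
have := colours_signed cP YY (subsetP (coloursS c XY) a aX).
by rewrite (_ : opp a = b) ?bY //; rewrite [b]surjective_pairing ba b2.
Qed.

Lemma kneser_label_bound n k p (c : signed_subset n k -> pm p) :
  0 < k -> forall X : {set pm n}, X != set0 -> X :&: oppset X = set0 ->
  (kneser_label c X).1 < k.-1 + p.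
Proof.
move=> k_gt0 X X0 XX; rewrite /kneser_label; have [Xk|kX] := ltnP #|X| k => /=.
  by rewrite (leq_trans _ (leq_addr _ _)) // -ltnS !prednK // card_gt0.
by have [a [-> _ _]] := top_colourP c kX XX; rewrite /= ltn_add2l ltn_ord.
Qed.

Theorem theorem6 (n k : nat) (hk : 1 <= k) (hkn : k <= n) :
  is_balanced_chromatic_number (KS n k) (n - k + 1).
Proof.
split=> [|p /KS_colourableP[c cP]]; first exact: KS_colourable.
have n_le : n <= k.-1 + p.
  exact: octahedral_tucker (kneser_label_tucker cP) (kneser_label_bound c hk).
by rewrite -(leq_add2l k) addnA subnKC // addn1 -(prednK hk) addSn ltnS.
Qed.
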